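(* Let $\rho_1,\rho_2$ be density operators (positive semi-definite, unit trace) on a finite-dimensional complex Hilbert space $\mathscr H$ with $\operatorname{supp}\rho_1\cap\operatorname{supp}\rho_2=\{0\}$ and $\operatorname{supp}\rho_1\cap\ker\rho_2=\{0\}$. Let $0<p_1<1$ and $\mathcal S=(\gamma_1,\gamma_2)=(p_1\rho_1,(1-p_1)\rho_2)$. Let $\sqrt{\rho_1}^{\,-}$ denote the inverse of $\sqrt{\rho_1}$ on its support (extended by zero on $\ker\rho_1$), let $\lambda_1>0$ be the smallest non-vanishing eigenvalue of $\sqrt{\rho_1}^{\,-}\rho_2\sqrt{\rho_1}^{\,-}$, and put $\ell_1=\lambda_1/(1+\lambda_1)$. Then single state detection of $\gamma_2$ is optimal for $\mathcal S$ (i.e. an optimal USD measurement $(E_1,E_2,E_?)$ of $\mathcal S$ with $\operatorname{tr}(E_1\gamma_1)=0$ exists) if and only if $0<p_1\le\ell_1$.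
   Context: For a positive semi-definite operator $\rho$, $\operatorname{supp}\rho=(\ker\rho)^\perp$. A USD (unambiguous state discrimination) measurement of a pair $\mathcal S=(\gamma_1,\gamma_2)$ of positive semi-definite operators is a triple $\mathcal E=(E_1,E_2,E_?)$ of positive semi-definite operators on $\mathscr H$ with $E_1+E_2+E_?=1$ (identity), $\operatorname{tr}(E_2\gamma_1)=0$ and $\operatorname{tr}(E_1\gamma_2)=0$. Its success probability is $\operatorname{tr}(E_1\gamma_1)+\operatorname{tr}(E_2\gamma_2)$; it is optimal if its success probability is maximal among all USD measurements of $\mathcal S$. *)

(* Defs.v *)
From HB Require Import structures.
From mathcomp Require Import all_boot all_order all_algebra.
From mathcomp Require Import spectral sesquilinear reals complex.

Set Implicit Arguments.
Unset Strict Implicit.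
Unset Printing Implicit Defensive.

Import Order.TTheory GRing.Theory Num.Theory Num.Def.
Local Open Scope ring_scope.
Local Open Scope sesquilinear_scope.

(* The Hilbert space is C^n, with the inner product [dotmx]. As everywhere in
   mxalgebra, vectors are rows and an operator A acts by u |-> u *m A, so that
   kernels, eigenvalues and subspaces are the library's row notions [kermx],
   [eigenvalue] and the scope %MS. *)

Section Operators.
Context {C : numClosedFieldType} {n : nat}.
Implicit Types (A B : 'M[C]_n) (u v w : 'rV[C]_n).

Definition psdmx A : Prop :=
  A \is hermsymmx /\ forall u, 0 <= dotmx (u *m A) u.

Definition density_operator A : Prop := psdmx A /\ \tr A = 1.

(* [orthomx conjC 1%:M B] is the orthogonal complement of the row space of B. *)
Definition suppmx A : 'M[C]_n := orthomx conjC 1%:M (kermx A).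

(* f(A) for a normal operator A, by unitary diagonalization. *)
Definition specfun (f : C -> C) A : 'M[C]_n :=
  invmx (spectralmx A) *m diag_mx (map_mx f (spectral_diag A)) *m spectralmx A.

Definition sqrtmx A : 'M[C]_n := specfun sqrtC A.

(* Since 0^-1 = 0, this inverts A on its support and vanishes on its kernel;
   see [supp_invmx_supp] and [supp_invmx_ker]. *)
Definition supp_invmx A : 'M[C]_n := specfun GRing.inv A.

Definition smallest_nonzero_eigenvalue A (a : C) : Prop :=
  [/\ eigenvalue A a, a != 0 &
      forall b, eigenvalue A b -> b != 0 -> a <= b].

End Operators.

Section UnambiguousDiscrimination.
Context {C : numClosedFieldType} {n : nat}.
Implicit Types g E F Eq Fq : 'M[C]_n.

Definition usd_measurement g1 g2 E1 E2 Eq : Prop :=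
  [/\ [/\ psdmx E1, psdmx E2 & psdmx Eq], E1 + E2 + Eq = 1%:M,
      \tr (E2 *m g1) = 0 & \tr (E1 *m g2) = 0].

(* A real number when the four operators are positive semi-definite; in the
   order of C, comparing two such values is comparing two reals. *)
Definition success_probability g1 g2 E1 E2 : C :=
  \tr (E1 *m g1) + \tr (E2 *m g2).

Definition optimal_usd_measurement g1 g2 E1 E2 Eq : Prop :=
  usd_measurement g1 g2 E1 E2 Eq /\
  forall F1 F2 Fq, usd_measurement g1 g2 F1 F2 Fq ->
    success_probability g1 g2 F1 F2 <= success_probability g1 g2 E1 E2.

Definition single_state_detection_2_optimal g1 g2 : Prop :=
  exists E1 E2 Eq,
    optimal_usd_measurement g1 g2 E1 E2 Eq /\ \tr (E1 *m g1) = 0.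

End UnambiguousDiscrimination.

Section OperatorFacts.
Context {C : numClosedFieldType} {n : nat}.
Implicit Types (A B : 'M[C]_n) (u v w : 'rV[C]_n).

Lemma hermsymmxE A : (A \is hermsymmx) = (A == A^t*).
Proof. by rewrite qualifE /= expr0 scale1r. Qed.

Lemma specfunM f g A :
  specfun f A *m specfun g A = specfun (fun x => f x * g x) A.
Proof.
rewrite /specfun -!mulmxA [spectralmx A *m _]mulmxA mulmxV ?spectral_unit//.
rewrite mul1mx (mulmxA (diag_mx _)) mulmx_diag !mulmxA.
by congr (_ *m _ *m _); congr diag_mx; apply/rowP => i; rewrite !mxE.
Qed.

Lemma eq_specfun f g A : f =1 g -> specfun f A = specfun g A.
Proof.
move=> fg; rewrite /specfun; congr (_ *m _ *m _); congr diag_mx.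
by apply/rowP => i; rewrite !mxE fg.
Qed.

Lemma specfun_id A : A \is hermsymmx -> specfun id A = A.
Proof.
move=> /hermitian_normalmx/orthomx_spectralP {2}->.
by rewrite /specfun map_mx_id.
Qed.

Lemma psd_spectral_diag A i : psdmx A -> 0 <= spectral_diag A 0 i.
Proof.
move=> [hA posA]; have := posA (row i (spectralmx A)).
have /orthomx_spectralP {2}-> := hermitian_normalmx hA.
rewrite -row_mul !mulmxA mulmxV ?spectral_unit// mul1mx.
rewrite row_mul row_diag_mx -scalemxAl -rowE dotmxE -scalemxAl mxE -dotmxE.
by have /row_unitarymxP-> := spectral_unitarymx A; rewrite eqxx mulr1.
Qed.

Lemma psd_specfun f A :
  (forall i, 0 <= f (spectral_diag A 0 i)) -> psdmx (specfun f A).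
Proof.
move=> fpos; have iP := invmx_unitary (spectral_unitarymx A); split.
  rewrite hermsymmxE /specfun iP; apply/eqP.
  rewrite !trmx_mul !map_mxM/= trmxCK mulmxA; congr (_ *m _ *m _).
  apply/matrixP => i j; rewrite !mxE eq_sym; case: eqP => [->|_].
    by rewrite !mulr1n conj_Creal// ger0_real.
  by rewrite !mulr0n conjC0.
move=> u; rewrite dotmxE /specfun iP !mulmxA.
set v := u *m (spectralmx A)^t*.
have -> : v *m diag_mx (map_mx f (spectral_diag A)) *m spectralmx A *m u^t* =
   v *m diag_mx (map_mx f (spectral_diag A)) *m v^t*.
  by rewrite -(mulmxA _ (spectralmx A)) /v trmx_mul map_mxM/= trmxCK.
rewrite mxE sumr_ge0// => j _; rewrite mul_mx_diag !mxE mulrAC.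
by rewrite mulr_ge0// mul_conjC_ge0.
Qed.

Lemma psd_sqrtmx A : psdmx A -> psdmx (sqrtmx A).
Proof.
by move=> pA; apply: psd_specfun => i; rewrite sqrtC_ge0 psd_spectral_diag.
Qed.

Lemma sqrtmxK A : psdmx A -> sqrtmx A *m sqrtmx A = A.
Proof.
move=> [hA _]; rewrite /sqrtmx specfunM -[RHS]specfun_id//.
by apply: eq_specfun => x; rewrite -expr2 sqrtCK.
Qed.

Lemma supp_invmx_ker A u :
  A \is hermsymmx -> u *m A = 0 -> u *m supp_invmx A = 0.
Proof.
move=> hA uA0; have -> : supp_invmx A = A *m (supp_invmx A *m supp_invmx A).
  rewrite -[X in X *m _]specfun_id// /supp_invmx !specfunM.
  apply: eq_specfun => x; have [->|x0] := eqVneq x 0; first by rewrite invr0 mul0r.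
  by rewrite mulVKf.
by rewrite mulmxA uA0 mul0mx.
Qed.

Lemma supp_invmxC A :
  A \is hermsymmx -> A *m supp_invmx A = supp_invmx A *m A.
Proof.
move=> hA; rewrite -[X in X *m _]specfun_id// -[X in _ = _ *m X]specfun_id//.
by rewrite /supp_invmx !specfunM; apply: eq_specfun => x; rewrite mulrC.
Qed.

Lemma supp_invmx_supp A u : A \is hermsymmx -> (u <= suppmx A)%MS ->
  u *m A *m supp_invmx A = u /\ u *m supp_invmx A *m A = u.
Proof.
move=> hA uS; suff E : u *m A *m supp_invmx A = u.
  by split=> //; rewrite -mulmxA -supp_invmxC// mulmxA.
set Q := A *m supp_invmx A.
have hQ : Q^t* = Q.
  apply/esym/eqP; rewrite -hermsymmxE /Q -[X in X *m _]specfun_id//.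
  rewrite /supp_invmx specfunM.
  apply: (psd_specfun _).1 => i.
  by have [->|x0] := eqVneq (spectral_diag A 0 i) 0; rewrite ?mul0r// divff.
rewrite -mulmxA -/Q; apply/eqP; rewrite eq_sym -subr_eq0 -submx0.
rewrite -(orthomx_ortho_disj (kermx A)) sub_capmx; apply/andP; split.
  apply/sub_kermxP; rewrite mulmxBl /Q.
  suff AQ : A *m supp_invmx A *m A = A by rewrite -(mulmxA u) AQ subrr.
  rewrite -{1 3 4}[A]specfun_id// /supp_invmx !specfunM; apply: eq_specfun => x.
  by have [->|x0] := eqVneq x 0; rewrite ?mul0r// divfK.
rewrite addmx_sub// eqmx_opp; apply/orthomx1P.
rewrite -mulmxA -{1}hQ -map_mxM -trmx_mul /Q mulmxA mulmx_ker mul0mx.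
by rewrite trmx0 map_mx0 mulmx0.
Qed.

End OperatorFacts.

(* Main.v *)
Require Import Defs.
From HB Require Import structures.
From mathcomp Require Import all_boot all_order all_algebra.
From mathcomp Require Import spectral sesquilinear reals complex.
From mathcomp Require Import ring lra.

Set Implicit Arguments.
Unset Strict Implicit.
Unset Printing Implicit Defensive.

Import Order.TTheory GRing.Theory Num.Theory.
Local Open Scope ring_scope.
Local Open Scope complex_scope.

(* Let P be the projection onto the support of g1 and Q = 1 - P. A detector of
   g2 lives in ker g1, so single state detection of g2 succeeds with probability
   at most tr(Q g2), attained by (0, Q, P); it is optimal iff P g2 P >= g1.
   If P g2 P >= g1, any F1 with F1 g2 = 0 satisfies
     tr(F1 g1) <= tr(F1 P g2 P) = tr(Q F1 Q g2),
   so F succeeds with probability at most tr(Q (F1 + F2) Q g2) <= tr(Q g2).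
   Otherwise take v in supp g1 with <v, g2 v> < <v, g1 v>. The supports meet
   trivially, hence the kernels span and v = a + w with a in ker g1, w in ker g2;
   a little detection of g1 along w, paid for along a, beats tr(Q g2).
   Finally P rho2 P >= lambda1 rho1 is sharp, because conjugating it by the
   inverse root of rho1 gives the spectral gap of the operator whose smallest
   nonzero eigenvalue is lambda1. *)

(** * Adjoints and the Frobenius norm *)

Section Adjoint.
Local Open Scope sesquilinear_scope.
Context {C : numClosedFieldType}.

Lemma adjmxM m n p (A : 'M[C]_(m, n)) (B : 'M[C]_(n, p)) :
  (A *m B)^t* = B^t* *m A^t*.
Proof. by rewrite trmx_mul map_mxM. Qed.

Lemma adjmxD m n (A B : 'M[C]_(m, n)) : (A + B)^t* = A^t* + B^t*.
Proof. by rewrite linearD map_mxD. Qed.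

Lemma adjmxN m n (A : 'M[C]_(m, n)) : (- A)^t* = - A^t*.
Proof. by rewrite linearN map_mxN. Qed.

Lemma adjmxZ m n (c : C) (A : 'M[C]_(m, n)) : 0 <= c ->
  (c *: A)^t* = c *: A^t*.
Proof. by move=> c0; rewrite linearZ map_mxZ /= conj_Creal// ger0_real. Qed.

Lemma adjmx1 n : (1%:M : 'M[C]_n)^t* = 1%:M.
Proof. by rewrite trmx1 map_mx1. Qed.

Lemma mulmx_adj_ge0 n (v : 'rV[C]_n) : 0 <= (v *m v^t*) 0 0.
Proof. by rewrite mxE sumr_ge0// => k _; rewrite !mxE mul_conjC_ge0. Qed.

Lemma tr_mulmx_adj_eq0 m n (A : 'M[C]_(m, n)) : \tr (A *m A^t*) = 0 -> A = 0.
Proof.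
move=> /eqP; rewrite /mxtrace psumr_eq0; last first.
  by move=> i _; rewrite mxE sumr_ge0// => k _; rewrite !mxE mul_conjC_ge0.
move=> /allP A0; apply/matrixP => i j; rewrite !mxE.
have /eqP := A0 i (mem_index_enum i); rewrite mxE => /eqP.
rewrite psumr_eq0; last by move=> k _; rewrite !mxE mul_conjC_ge0.
move=> /allP/(_ j (mem_index_enum j)).
by rewrite !mxE mul_conjC_eq0 => /eqP.
Qed.

Lemma mulmx_adj_gt0 n (v : 'rV[C]_n) : v != 0 -> 0 < (v *m v^t*) 0 0.
Proof.
move=> v0; rewrite lt0r mulmx_adj_ge0 andbT; apply: contra v0 => /eqP v0.
by apply/eqP/tr_mulmx_adj_eq0; rewrite trace_mx11.
Qed.

End Adjoint.

(** * Positive semi-definite operators: congruences, roots, traces *)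

Section PositiveOperators.
Local Open Scope sesquilinear_scope.
Context {C : numClosedFieldType} {n : nat}.
Implicit Types (A B X : 'M[C]_n).

Lemma psdmxP A :
  psdmx A <-> A^t* = A /\ forall u : 'rV_n, 0 <= (u *m A *m u^t*) 0 0.
Proof.
split=> [[hA posA]|[hA posA]]; split.
- by move: hA; rewrite hermsymmxE => /eqP.
- by move=> u; rewrite -dotmxE.
- by rewrite hermsymmxE hA.
- by move=> u; rewrite dotmxE.
Qed.

Lemma psd_adj A : psdmx A -> A^t* = A.
Proof. by case/psdmxP. Qed.

Lemma psdD A B : psdmx A -> psdmx B -> psdmx (A + B).
Proof.
move=> /psdmxP[hA pA] /psdmxP[hB pB]; apply/psdmxP; split.
  by rewrite adjmxD hA hB.
by move=> u; rewrite mulmxDr mulmxDl mxE addr_ge0.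
Qed.

Lemma psdZ c A : 0 <= c -> psdmx A -> psdmx (c *: A).
Proof.
move=> c0 /psdmxP[hA pA]; apply/psdmxP; split; first by rewrite adjmxZ// hA.
by move=> u; rewrite -scalemxAr -scalemxAl mxE mulr_ge0.
Qed.

Lemma psd_congr X A : psdmx A -> psdmx (X *m A *m X^t*).
Proof.
move=> /psdmxP[hA pA]; apply/psdmxP; split.
  by rewrite !adjmxM trmxCK hA mulmxA.
by move=> u; have := pA (u *m X); rewrite adjmxM !mulmxA.
Qed.

Lemma psd_gram m (v : 'M[C]_(m, n)) : psdmx (v^t* *m v).
Proof.
apply/psdmxP; split; first by rewrite adjmxM trmxCK.
move=> u; have -> : u *m (v^t* *m v) *m u^t* = (u *m v^t*) *m (u *m v^t*)^t*.
  by rewrite adjmxM trmxCK !mulmxA.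
exact: mulmx_adj_ge0.
Qed.

Lemma psd1 : psdmx (1%:M : 'M[C]_n).
Proof. by rewrite -(mul1mx 1%:M) -{1}adjmx1; exact: psd_gram. Qed.

Lemma psd0 : psdmx (0 : 'M[C]_n).
Proof. by rewrite -(scale0r 1%:M); apply: psdZ => //; exact: psd1. Qed.

Lemma psd_tr_ge0 A : psdmx A -> 0 <= \tr A.
Proof.
move=> /psdmxP[_ pA]; apply: sumr_ge0 => i _; have := pA (delta_mx 0 i).
by rewrite -rowE trmx_delta map_delta_mx -colE !mxE.
Qed.

Lemma psd_root A : psdmx A -> exists2 S : 'M[C]_n, S^t* = S & S *m S = A.
Proof.
move=> pA; exists (sqrtmx A); last exact: sqrtmxK.
exact/psd_adj/psd_sqrtmx.
Qed.

Lemma psd_tr_mul_ge0 A B : psdmx A -> psdmx B -> 0 <= \tr (A *m B).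
Proof.
move=> /psd_root[S hS <-] pB; have := psd_tr_ge0 (psd_congr S pB).
by rewrite hS mxtrace_mulC mulmxA.
Qed.

(** For Hermitian roots [S], [T] of [A], [B], the trace is the squared Frobenius norm of [S *m T].
    This turns the error conditions of a measurement into operator identities. *)
Lemma psd_tr_mul_eq0 A B : psdmx A -> psdmx B -> \tr (A *m B) = 0 ->
  A *m B = 0 /\ B *m A = 0.
Proof.
move=> /psd_root[S hS <-] /psd_root[T hT <-] ST0.
have E : S *m T = 0.
  apply: tr_mulmx_adj_eq0.
  by rewrite adjmxM hS hT mulmxA mxtrace_mulC !mulmxA -mulmxA.
have E' : T *m S = 0 by rewrite -hS -hT -adjmxM E trmx0 map_mx0.
by rewrite !mulmxA -(mulmxA S) E -(mulmxA T T) E' !(mulmx0, mul0mx).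
Qed.

Lemma psd_isotropic m (A : 'M[C]_n) (u : 'M[C]_(m, n)) :
  psdmx A -> u *m A *m u^t* = 0 -> u *m A = 0.
Proof.
move=> /psd_root[S hS <-] uA0; suff uS0 : u *m S = 0 by rewrite mulmxA uS0 mul0mx.
by apply: tr_mulmx_adj_eq0; rewrite adjmxM hS mulmxA -(mulmxA u) uA0 mxtrace0.
Qed.

(* With [X = v^t* *m v] one has [X^2 = |v|^2 X], so that
   [1 - b X = (1 - b X)^2 + b (1 - b |v|^2) X]. *)
Lemma psd_sub1_gram (b : C) (v : 'rV[C]_n) : 0 <= b ->
  b * (v *m v^t*) 0 0 <= 1 -> psdmx (1%:M - b *: (v^t* *m v)).
Proof.
move=> b0 bv; set X := v^t* *m v; set s := (v *m v^t*) 0 0 in bv *.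
have pX : psdmx X by exact: psd_gram.
have XX : X *m X = s *: X.
  rewrite /X mulmxA -(mulmxA _ v) [v *m v^t*]mx11_scalar -/s.
  by rewrite mul_mx_scalar -scalemxAl.
have hY : (1%:M - b *: X)^t* = 1%:M - b *: X.
  by rewrite adjmxD adjmxN adjmxZ// adjmx1 (psd_adj pX).
have -> : 1%:M - b *: X =
    (1%:M - b *: X) *m 1%:M *m (1%:M - b *: X)^t* + (b * (1 - b * s)) *: X.
  rewrite hY mulmx1 mulmxBl mul1mx mulmxBr mulmx1 -scalemxAl -scalemxAr XX !scalerA.
  suff -> : b *: X - (b * b * s) *: X = (b * (1 - b * s)) *: X by rewrite subrK.
  by rewrite mulrBr mulr1 mulrA scalerBl.
apply: psdD; first exact/psd_congr/psd1.
by apply: psdZ => //; rewrite mulr_ge0// subr_ge0.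
Qed.

End PositiveOperators.

(** * Orthogonal projections onto supports *)

Section SupportProjection.
Local Open Scope sesquilinear_scope.
Context {C : numClosedFieldType} {n : nat}.
Implicit Types (A B P X E F g : 'M[C]_n).

(** For Hermitian [A] this characterises the orthogonal projection onto its support: [A *m P = A]
    makes [P] fix the row space of [A], and [P = A *m X] makes it vanish on the kernel. Idempotence
    follows. *)
Definition supp_projection A P : Prop :=
  [/\ P^t* = P, A *m P = A & exists X, P = A *m X].

Lemma supp_projection_idem A P : A^t* = A -> supp_projection A P -> P *m P = P.
Proof.
move=> hA [hP AP [X PE]]; have PE' : P = X^t* *m A.
  by rewrite -hA -adjmxM -PE hP.
by rewrite {1}PE' -mulmxA AP -PE'.
Qed.

Lemma supp_projectionK A P m (u : 'M[C]_(m, n)) :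
  supp_projection A P -> u *m A = 0 -> u *m P = 0.
Proof. by move=> [_ _ [X ->]] uA; rewrite mulmxA uA mul0mx. Qed.

Lemma supp_projection_supp A P : A^t* = A -> supp_projection A P ->
  (P <= suppmx A)%MS.
Proof.
move=> hA [hP AP [X PE]]; apply/orthomx1P.
rewrite -[LHS]trmxCK adjmxM trmxCK hP PE mulmxA mulmx_ker mul0mx.
by rewrite trmx0 map_mx0.
Qed.

Lemma supp_projectionZ c A P : c != 0 -> supp_projection A P ->
  supp_projection (c *: A) P.
Proof.
move=> c0 [hP AP [X PE]]; split=> //; first by rewrite -scalemxAl AP.
by exists (c^-1 *: X); rewrite -scalemxAl -scalemxAr scalerA mulfV// scale1r.
Qed.

End SupportProjection.

(** * Optimality of detecting [g2] alone: comparison of [P *m g2 *m P] with [g1] *)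

Section Discrimination.
Local Open Scope sesquilinear_scope.
Context {C : numClosedFieldType} {n : nat}.
Variables (g1 g2 P : 'M[C]_n).
Hypotheses (pg1 : psdmx g1) (pg2 : psdmx g2) (sP : supp_projection g1 P).
Implicit Types (E F : 'M[C]_n).

Let Q := 1%:M - P.

Let hP : P^t* = P. Proof. by case: sP. Qed.
Let PP : P *m P = P. Proof. exact: supp_projection_idem (psd_adj pg1) sP. Qed.
Let g1P : g1 *m P = g1. Proof. by case: sP. Qed.
Let Pg1 : P *m g1 = g1.
Proof. by rewrite -hP -(psd_adj pg1) -adjmxM g1P. Qed.
Let hQ : Q^t* = Q. Proof. by rewrite adjmxD adjmxN adjmx1 hP. Qed.
Let QQ : Q *m Q = Q.
Proof. by rewrite /Q mulmxBl mul1mx mulmxBr mulmx1 PP subrr subr0. Qed.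
Let Qg1 : Q *m g1 = 0. Proof. by rewrite mulmxBl mul1mx Pg1 subrr. Qed.
Let pQ : psdmx Q. Proof. by rewrite -QQ -{1}hQ; exact: psd_gram. Qed.
Let pP : psdmx P. Proof. by rewrite -PP -{1}hP; exact: psd_gram. Qed.

Let mulmxQ E : psdmx E -> E *m g1 = 0 -> Q *m E *m Q = E.
Proof.
move=> pE /(supp_projectionK sP) EP.
have PE : P *m E = 0 by rewrite -hP -(psd_adj pE) -adjmxM EP trmx0 map_mx0.
by rewrite mulmxBl mul1mx PE subr0 mulmxBr mulmx1 EP subr0.
Qed.

Let tr_compression_le E : psdmx (1%:M - E) ->
  \tr (Q *m E *m Q *m g2) <= \tr (Q *m g2).
Proof.
move=> pE; rewrite -subr_ge0 -raddfB -mulmxBl /=.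
have -> : Q - Q *m E *m Q = Q *m (1%:M - E) *m Q^t*.
  by rewrite hQ (mulmxBr Q 1%:M E) mulmx1 (mulmxBl Q _ Q) QQ.
exact/psd_tr_mul_ge0/pg2/psd_congr.
Qed.

Lemma usd_tr2_le E1 E2 Eq : usd_measurement g1 g2 E1 E2 Eq ->
  \tr (E2 *m g2) <= \tr (Q *m g2).
Proof.
move=> [[pE1 pE2 pEq] E E2g1 _]; have [E20 _] := psd_tr_mul_eq0 pE2 pg1 E2g1.
rewrite -{1}(mulmxQ pE2 E20); apply: tr_compression_le.
by rewrite -E addrAC addrK; exact: psdD.
Qed.

Lemma ker_projection_usd : usd_measurement g1 g2 0 Q P.
Proof.
split; last by rewrite mul0mx mxtrace0.
- by split=> //; exact: psd0.
- by rewrite add0r subrK.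
- by rewrite Qg1 mxtrace0.
Qed.

Lemma detection_2_optimal_of_ge : psdmx (P *m g2 *m P - g1) ->
  single_state_detection_2_optimal g1 g2.
Proof.
move=> pD; exists 0, Q, P; split; last by rewrite mul0mx mxtrace0.
split; first exact: ker_projection_usd.
move=> F1 F2 Fq [[pF1 pF2 pFq] E F2g1 F1g2].
have [F20 _] := psd_tr_mul_eq0 pF2 pg1 F2g1.
have [F1g20 g2F10] := psd_tr_mul_eq0 pF1 pg2 F1g2.
rewrite /success_probability mul0mx mxtrace0 add0r.
apply: le_trans (tr_compression_le (E := F1 + F2) _); last first.
  by rewrite -E addrAC subrr add0r.
rewrite (mulmxDr Q) (mulmxDl (Q *m F1)) (mulmxDl (Q *m F1 *m Q)) (mulmxQ pF2 F20) mxtraceD lerD2r.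
have := psd_tr_mul_ge0 pF1 pD; rewrite mulmxBr raddfB subr_ge0 /= => /le_trans; apply.
suff -> : \tr (F1 *m (P *m g2 *m P)) = \tr (Q *m F1 *m Q *m g2) by [].
have PE : P = 1%:M - Q by rewrite opprB addrC subrK.
(* Replace each [P] by [1 - Q]: the first replacement uses [F1 *m g2 = 0], and the leftover term has
   trace zero by cyclicity and [g2 *m F1 = 0]. *)
have -> : F1 *m (P *m g2 *m P) = F1 *m Q *m g2 *m Q - F1 *m Q *m g2.
  rewrite !mulmxA {1}PE (mulmxBr F1 _ Q) mulmx1 (mulmxBl F1) F1g20 sub0r mulNmx.
  by rewrite {1}PE (mulmxBr _ _ Q) mulmx1 opprB.
rewrite raddfB /= [X in _ - X]mxtrace_mulC [g2 *m _]mulmxA g2F10 mul0mx mxtrace0 subr0.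
by rewrite mxtrace_mulC !mulmxA.
Qed.

(* Witness of non-optimality: with [w = v - a], detect [g1] by [e w* w] and
   shrink the detector of [g2] to [Q - e (1 + t) a* a]. *)
Lemma detection_2_suboptimal (v a : 'rV[C]_n) (t : C) :
  v *m P = v -> a *m g1 = 0 -> (v - a) *m g2 = 0 -> 0 < t ->
  (1 + t) * (v *m g2 *m v^t*) 0 0 < (v *m g1 *m v^t*) 0 0 ->
  ~ single_state_detection_2_optimal g1 g2.
Proof.
move=> vP ag1 wg2 t0 gain [E1 [E2 [Eq [[usdE optE] E1g1]]]].
set w := v - a in wg2.
have aP : a *m P = 0 by exact: supp_projectionK sP ag1.
have aQ : a *m Q = a by rewrite mulmxBr mulmx1 aP subr0.
pose nv := (v *m v^t*) 0 0; pose na := (a *m a^t*) 0 0.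
have nv0 : 0 <= nv by exact: mulmx_adj_ge0.
have na0 : 0 <= na by exact: mulmx_adj_ge0.
have t10 : 0 < 1 + t by rewrite addr_gt0.
have ti0 : 0 < 1 + t^-1 by rewrite addr_gt0 ?invr_gt0.
(* [D] dominates both norm terms, so the single scale [e = 1/D] meets the bounds under which
   [psd_sub1_gram] gives positivity of [Fq] and [F2]. *)
pose D := 1 + (1 + t^-1) * nv + (1 + t) * na.
have D0 : 0 < D by rewrite ltr_wpDr ?ltr_wpDr ?mulr_ge0 ?(ltW t10) ?(ltW ti0).
pose e := D^-1.
have e0 : 0 < e by rewrite invr_gt0.
have ev : e * (1 + t^-1) * nv <= 1.
  rewrite -mulrA mulrC ler_pdivrMr// mul1r /D addrAC lerDr.
  by rewrite addr_ge0 ?mulr_ge0// ltW.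
have ea : e * (1 + t) * na <= 1.
  rewrite -mulrA mulrC ler_pdivrMr// mul1r /D lerDr.
  by rewrite addr_ge0 ?mulr_ge0// ltW.
pose F1 := e *: (w^t* *m w).
pose F2 := Q - (e * (1 + t)) *: (a^t* *m a).
pose Fq := P + (e * (1 + t)) *: (a^t* *m a) - F1.
have pF1 : psdmx F1 by apply: psdZ (ltW e0) _; exact: psd_gram.
(* Compression by a projection fixing [u] carries positivity from [1 - c u* u] to [X - c u* u]; used
   with [Q], [a] and with [P], [v]. *)
have compress (X : 'M[C]_n) (u : 'rV[C]_n) c : X^t* = X -> X *m X = X -> u *m X = u ->
    X *m (1%:M - c *: (u^t* *m u)) *m X^t* = X - c *: (u^t* *m u).
  move=> hX XX uX; have Xu : X *m u^t* = u^t* by rewrite -{1}hX -adjmxM uX.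
  rewrite mulmxBr mulmx1 mulmxBl hX XX -scalemxAr -scalemxAl.
  by rewrite mulmxA Xu -mulmxA uX.
have pF2 : psdmx F2.
  rewrite /F2 -compress//; apply/psd_congr/psd_sub1_gram => //.
  by rewrite mulr_ge0 ?(ltW e0)// ltW.
have pFq : psdmx Fq.
  (* Young's inequality with its remainder: for [w = v - a], [(1 + t) a* a + (1 + 1/t) v* v - w* w]
     equals [(1/t) (v + t a)* (v + t a)]. *)
  have -> : Fq = (P - (e * (1 + t^-1)) *: (v^t* *m v)) +
                 (e * t^-1) *: ((v + t *: a)^t* *m (v + t *: a)).
    rewrite /Fq /F1 /w !adjmxD adjmxN adjmxZ ?(ltW t0)//.
    apply/matrixP => i j.
    rewrite !(mulmxDl, mulmxDr, mulmxN, mulNmx) -?scalemxAl -?scalemxAr !mxE.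
    set x1 := (\sum_ _ _); set x2 := (\sum_ _ _).
    by field; rewrite gt_eqF.
  apply: psdD; last first.
    apply/psdZ/psd_gram; apply: mulr_ge0 (ltW e0) _.
    by rewrite invr_ge0 ltW.
  rewrite -compress//; apply/psd_congr/psd_sub1_gram => //.
  by rewrite mulr_ge0 ?(ltW e0)// ltW.
(* Both forms can be evaluated at [v]: [w] and [v] differ by a vector of ker [g1], [a] and [v] by
   one of ker [g2]. The net gain over tr(Q g2) is thus [e] times the difference in the
   hypothesis. *)
have w1 : w *m g1 = v *m g1 by rewrite mulmxBl ag1 subr0.
have g1w : g1 *m w^t* = g1 *m v^t*.
  by rewrite -(psd_adj pg1) -!adjmxM w1.
have a2 : a *m g2 = v *m g2 by apply/esym/eqP; rewrite -subr_eq0 -mulmxBl wg2.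
have g2a : g2 *m a^t* = g2 *m v^t*.
  by rewrite -(psd_adj pg2) -!adjmxM a2.
have usdF : usd_measurement g1 g2 F1 F2 Fq.
  split=> //.
  - rewrite /F2 /Fq /F1 /Q.
    by apply/matrixP => i j; rewrite !mxE; ring.
  - by rewrite /F2 mulmxBl Qg1 -scalemxAl -mulmxA ag1 mulmx0 scaler0 subrr mxtrace0.
  - by rewrite /F1 -scalemxAl -mulmxA wg2 mulmx0 scaler0 mxtrace0.
have trE (u : 'rV[C]_n) (g : 'M[C]_n) : \tr (u^t* *m u *m g) = (u *m g *m u^t*) 0 0.
  by rewrite -mulmxA mxtrace_mulC trace_mx11.
have := le_trans (optE _ _ _ usdF) _; rewrite /success_probability.
rewrite E1g1 add0r => /(_ _ (usd_tr2_le usdE)).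
rewrite /F1 /F2 (mulmxBl Q) -!scalemxAl (raddfB (@mxtrace C n)) /= !mxtraceZ !trE w1 a2.
rewrite -!mulmxA g1w g2a !mulmxA.
rewrite addrCA gerDl subr_le0 -mulrA ler_pM2l//.
by move=> /(lt_le_trans gain); rewrite ltxx.
Qed.

End Discrimination.

(** * Pseudo-inverse roots, spectral gap, sums of kernels *)

Section Spectral.
Local Open Scope sesquilinear_scope.
Context {C : numClosedFieldType} {n : nat}.
Implicit Types (A B P S I : 'M[C]_n).

Lemma specfunBZ (f g : C -> C) c A :
  specfun f A - c *: specfun g A = specfun (fun x => f x - c * g x) A.
Proof.
rewrite /specfun scalemxAl scalemxAr -mulmxBl -mulmxBr; congr (_ *m _ *m _).
by apply/matrixP => i j; rewrite !mxE mulrnBl mulrnAr.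
Qed.

Lemma supp_invmxK A : A \is hermsymmx ->
  A *m supp_invmx A *m A = A /\ supp_invmx A *m A *m supp_invmx A = supp_invmx A.
Proof.
move=> hA; rewrite -{1 3 4 6}(specfun_id hA) /supp_invmx !specfunM; split.
  by apply: eq_specfun => x; have [->|x0] := eqVneq x 0; rewrite ?mul0r ?divfK.
apply: eq_specfun => x.
by have [->|x0] := eqVneq x 0; rewrite ?invr0 ?mul0r ?mulVf ?mul1r.
Qed.

Lemma psd_supp_invmx A : psdmx A -> psdmx (supp_invmx A).
Proof.
by move=> pA; apply: psd_specfun => i; rewrite invr_ge0 psd_spectral_diag.
Qed.

(** [I] is the Moore-Penrose inverse of a Hermitian root [S] of [A]; these identities let the
    criterion be proved by algebra, with [I *m S] as support projection. *)
Definition root_pinverse A S I : Prop :=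
  [/\ S^t* = S, S *m S = A & I^t* = I] /\
  [/\ S *m I = I *m S, S *m I *m S = S & I *m S *m I = I].

Lemma psd_root_pinverse A : psdmx A ->
  root_pinverse A (sqrtmx A) (supp_invmx (sqrtmx A)).
Proof.
move=> pA; have pS := psd_sqrtmx pA; have [hS _] := pS.
have [SIS ISI] := supp_invmxK hS; split; split=> //.
- exact: psd_adj.
- exact: sqrtmxK.
- exact/psd_adj/psd_supp_invmx.
- exact: supp_invmxC.
Qed.

Lemma root_pinverse_supp_projection A S I : root_pinverse A S I ->
  supp_projection A (I *m S).
Proof.
move=> [[hS AE hI] [SI SIS ISI]]; split.
- by rewrite adjmxM hI hS SI.
- by rewrite -AE -mulmxA (mulmxA S I) SIS.
- by exists (I *m I); rewrite -AE !mulmxA -(mulmxA S S I) SI mulmxA SIS SI.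
Qed.

Lemma spectral_diag_eigenvalue A i :
  A \is hermsymmx -> eigenvalue A (spectral_diag A 0 i).
Proof.
move=> hA; apply/eigenvalueP; exists (row i (spectralmx A)).
  have /orthomx_spectralP {2}-> := hermitian_normalmx hA.
  rewrite -row_mul !mulmxA mulmxV ?spectral_unit// mul1mx.
  by rewrite row_mul row_diag_mx -scalemxAl -rowE.
apply/eqP => r0; have /row_unitarymxP/(_ i i) := spectral_unitarymx A.
by rewrite dotmxE r0 mul0mx mxE eqxx => /eqP; rewrite eq_sym oner_eq0.
Qed.

Lemma psd_spectral_gap A (c : C) : psdmx A ->
  (forall b, eigenvalue A b -> b != 0 -> c <= b) ->
  exists2 P, supp_projection A P & psdmx (A - c *: P).
Proof.
(* Since [0 / 0 = 0], the function [x / x] is the indicator of nonzero [x], so this is the spectral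
   projection onto the support. *)
move=> pA gap; have [hA _] := pA; exists (specfun (fun x => x / x) A).
  split.
  - apply: psd_adj; apply: psd_specfun => i.
    by have [->|x0] := eqVneq (spectral_diag A 0 i) 0; rewrite ?mul0r ?divff.
  - rewrite -{1 3}(specfun_id hA) specfunM; apply: eq_specfun => x.
    by have [->|x0] := eqVneq x 0; rewrite ?mul0r ?mulrA ?mulfK.
  - by exists (supp_invmx A); rewrite -{2}(specfun_id hA) specfunM.
rewrite -{1}(specfun_id hA) specfunBZ; apply: psd_specfun => i.
have [->|x0] := eqVneq (spectral_diag A 0 i) 0; first by rewrite mul0r mulr0 subr0.
by rewrite divff// mulr1 subr_ge0 gap// spectral_diag_eigenvalue.
Qed.

Lemma orthomxS m p (A : 'M[C]_(m, n)) (B : 'M[C]_(p, n)) :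
  (A <= B)%MS -> (orthomx Num.Def.conjC 1%:M B <= orthomx Num.Def.conjC 1%:M A)%MS.
Proof.
move=> /submxP[D ->]; have /orthomx1P KB := submx_refl (orthomx Num.Def.conjC 1%:M B).
by apply/orthomx1P; rewrite adjmxM mulmxA KB mul0mx.
Qed.

(** The orthogonal complement of the sum lies in both supports, so it vanishes and the sum has full
    rank. *)
Lemma ker_adds_full A B : (suppmx A :&: suppmx B)%MS = 0 ->
  row_full (kermx A + kermx B)%MS.
Proof.
move=> AB0; rewrite /row_full.
set W := (kermx A + kermx B)%MS.
have W0 : orthomx Num.Def.conjC 1%:M W = 0.
  apply/eqP; rewrite -submx0 -AB0 sub_capmx.
  by apply/andP; split; apply: orthomxS; [exact: addsmxSl | exact: addsmxSr].
by have := add_rank_ortho W; rewrite W0 mxrank0 addn0 => ->.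
Qed.

End Spectral.

(** * The threshold for the prior probability *)

Section Criterion.
Local Open Scope sesquilinear_scope.
Context {C : numClosedFieldType} {n : nat}.
Variables (r1 r2 S I : 'M[C]_n) (c : C).
Hypotheses (pr1 : psdmx r1) (pr2 : psdmx r2) (rI : root_pinverse r1 S I).

(** With [M = I r2 I] and support projection [N], the gap gives [M >= c N]. Conjugation by [S]
    yields the claim once [N = P], which is where the trivial intersection with ker [r2] enters. *)
Lemma psd_compression_gap : (suppmx r1 :&: kermx r2)%MS = 0 ->
  (forall b, eigenvalue (I *m r2 *m I) b -> b != 0 -> c <= b) ->
  psdmx (I *m S *m r2 *m (I *m S) - c *: r1).
Proof.
move=> ker0; have sP := root_pinverse_supp_projection rI.
have [[hS SS hI] [SI SIS ISI]] := rI.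
have [M ME] : {M | M = I *m r2 *m I} by exists (I *m r2 *m I).
have [P PE] : {P | P = I *m S} by exists (I *m S).
have pM : psdmx M by rewrite ME -{2}hI; exact: psd_congr.
rewrite -ME -PE in sP SI ISI * => gap.
have [N sN pMN] := psd_spectral_gap pM gap.
have [hN MN [X NE]] := sN; have [hP _ _] := sP.
have NM : N *m M = M by rewrite -hN -(psd_adj pM) -adjmxM MN.
have PI : P *m I = I by [].
have IP : I *m P = I by rewrite -SI mulmxA -PE.
have PN : P *m N = N by rewrite NE ME !mulmxA PI.
have NP : N *m P = N by rewrite -hP -hN -adjmxM PN.
have PP := supp_projection_idem (psd_adj pr1) sP.
(* These rows lie in supp [r1] because [I = I P], and in ker [r2] because [(P - N) M = 0] makes the
   form of [r2] vanish on them. *)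
have ZI0 : (P - N) *m I = 0.
  apply/eqP; rewrite -submx0 -ker0 sub_capmx; apply/andP; split.
    rewrite -IP mulmxA; apply: submx_trans (submxMl _ _) _.
    exact: supp_projection_supp (psd_adj pr1) sP.
  apply/sub_kermxP; apply: psd_isotropic pr2 _.
  have ZM : (P - N) *m M = 0 by rewrite mulmxBl NM ME !mulmxA PI subrr.
  have -> : (P - N) *m I *m r2 *m ((P - N) *m I)^t* = (P - N) *m M *m (P - N)^t*.
    by rewrite adjmxM hI ME !mulmxA.
  by rewrite ZM mul0mx.
have PN_eq : P = N.
  apply/eqP; rewrite -subr_eq0; apply/eqP.
  have <- : (P - N) *m P = P - N by rewrite mulmxBl PP NP.
  by rewrite [X in _ *m X]PE mulmxA ZI0 mul0mx.
have -> : P *m r2 *m P - c *: r1 = S *m (M - c *: N) *m S^t*; last exact: psd_congr.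
rewrite hS mulmxBr mulmxBl -PN_eq -scalemxAr -scalemxAl; congr (_ - _ *: _).
  by rewrite ME !mulmxA SI -(mulmxA _ I S) -PE.
by rewrite PE mulmxA SIS SS.
Qed.

(** Shows the gap bound is sharp. For an eigenvector [u], take [v = u I]; as [c] is nonzero, [u]
    lies in the row space of [I], so [v S = u] and both forms reduce to the norm of [u]. *)
Lemma eigenvector_witness : c != 0 -> eigenvalue (I *m r2 *m I) c ->
  exists v : 'rV_n, [/\ v *m (I *m S) = v, 0 < (v *m r1 *m v^t*) 0 0 &
      (v *m r2 *m v^t*) 0 0 = c * (v *m r1 *m v^t*) 0 0].
Proof.
have [[hS SS hI] [SI SIS ISI]] := rI.
move=> c0 /eigenvalueP[u uM u0]; exists (u *m I).
have uP : u *m I *m S = u.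
  apply: (scalerI c0); rewrite !scalemxAl -uM -!mulmxA -SI.
  by rewrite (mulmxA I S) ISI.
have E1 : u *m I *m r1 *m (u *m I)^t* = u *m u^t*.
  by rewrite adjmxM hI -SS !mulmxA uP -(mulmxA u S I) SI mulmxA uP.
rewrite E1; split; first by rewrite -SI mulmxA -(mulmxA u I S) -(mulmxA u) ISI.
  exact: mulmx_adj_gt0.
rewrite adjmxM hI !mulmxA -(mulmxA u I r2) -(mulmxA u) uM -scalemxAl.
by rewrite mxE.
Qed.

Lemma detection_2_optimal_iff (p : C) :
  (suppmx r1 :&: suppmx r2)%MS = 0 -> (suppmx r1 :&: kermx r2)%MS = 0 ->
  0 < p -> p < 1 -> 0 < c -> smallest_nonzero_eigenvalue (I *m r2 *m I) c ->
  single_state_detection_2_optimal (p *: r1) ((1 - p) *: r2) <->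
  p <= c * (1 - p).
Proof.
move=> supp0 ker0 p0 p1 c0 [eigc cn0 gap].
have q0 : 0 < 1 - p by rewrite subr_gt0.
have pg1 : psdmx (p *: r1) by apply: psdZ => //; exact: ltW.
have pg2 : psdmx ((1 - p) *: r2) by apply: psdZ => //; exact: ltW.
have sP' : supp_projection (p *: r1) (I *m S).
  apply: supp_projectionZ; first by rewrite gt_eqF.
  exact: root_pinverse_supp_projection.
split=> [opt|le_p]; last first.
  apply: (detection_2_optimal_of_ge pg1 pg2 sP').
  move: (I *m S) (psd_compression_gap ker0 gap) => P pD.
  have -> : P *m ((1 - p) *: r2) *m P - p *: r1 =
      (1 - p) *: (P *m r2 *m P - c *: r1) + (c * (1 - p) - p) *: r1.
    rewrite -scalemxAr -scalemxAl scalerBr scalerA (scalerBl (c * (1 - p))).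
    by rewrite (mulrC c) addrA subrK.
  apply: psdD; apply: psdZ => //; first exact: ltW.
  by rewrite subr_ge0.
have [//|lt_p] := real_leP (gtr0_real p0) (gtr0_real (mulr_gt0 c0 q0)).
have [v [vP v1 v2]] := eigenvector_witness cn0 eigc.
have /sub_addsmxP[[a b] /= vE] : (v <= kermx r1 + kermx r2)%MS.
  by rewrite submx_full// ker_adds_full.
set q := c * (1 - p) in lt_p *.
have q_gt0 : 0 < q by rewrite mulr_gt0.
(* The gain condition is [(1 + t) q < p], that is [t q < p - q]; dividing by [1 + q] instead of [q]
   makes it strict. *)
pose t := (p - q) / (1 + q).
have q10 : 0 < 1 + q by rewrite addr_gt0.
case: (@detection_2_suboptimal _ _ _ _ _ pg1 pg2 sP' v (a *m kermx r1) t) => //.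
- by rewrite -scalemxAr -mulmxA mulmx_ker mulmx0 scaler0.
- by rewrite {1}vE addrAC subrr add0r -scalemxAr -mulmxA mulmx_ker mulmx0 scaler0.
- by rewrite divr_gt0// subr_gt0.
have formZ k (g : 'M[C]_n) : (v *m (k *: g) *m v^t*) 0 0 = k * (v *m g *m v^t*) 0 0.
  by rewrite -scalemxAr -scalemxAl mxE.
rewrite !formZ v2 !mulrA ltr_pM2r//.
rewrite -mulrA (mulrC _ c) -/q mulrDl mul1r -ltrBrDl /t mulrAC.
by rewrite ltr_pdivrMr// ltr_pM2l ?subr_gt0// ltrDr.
Qed.

End Criterion.

Theorem mainTheorem8 (R : realType) (n : nat) (rho1 rho2 : 'M[R[i]]_n)
  (p1 lambda1 : R)
  (hrho1 : density_operator rho1) (hrho2 : density_operator rho2)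
  (hsupp : (suppmx rho1 :&: suppmx rho2)%MS = 0)
  (hker : (suppmx rho1 :&: kermx rho2)%MS = 0)
  (hp1_gt0 : 0 < p1) (hp1_lt1 : p1 < 1)
  (hlambda1_gt0 : 0 < lambda1)
  (hlambda1 : smallest_nonzero_eigenvalue
     (supp_invmx (sqrtmx rho1) *m rho2 *m supp_invmx (sqrtmx rho1))
     lambda1%:C) :
  single_state_detection_2_optimal (p1%:C *: rho1) ((1 - p1)%:C *: rho2) <->
  0 < p1 <= lambda1 / (1 + lambda1).
Proof.
have [[pr1 _] [pr2 _]] := (hrho1, hrho2).
have l10 : 0 < 1 + lambda1 by rewrite addr_gt0.
(* Clearing the denominator gives [p1 (1 + lambda1) <= lambda1], a rearrangement of the criterion's
   inequality. *)
have -> : 0 < p1 <= lambda1 / (1 + lambda1) = (p1%:C <= lambda1%:C * (1 - p1%:C)).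
  rewrite hp1_gt0 /= ler_pdivlMr// -(rmorph1 (real_complex R)) -rmorphB -rmorphM.
  by rewrite lecR; apply/idP/idP; nra.
rewrite rmorphB rmorph1; apply: detection_2_optimal_iff (psd_root_pinverse pr1) _ _ _ _ _ _ _ => //; by rewrite ltcR.
Qed.
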